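(* Let $R$ be an associative unital ring, let $\mathcal F$ be a class of countably presented right $R$-modules, and let $\mathcal L$ be the class of all locally $\mathcal F$-free modules. Let $N$ be a Bass module over $\mathcal F$. Assume that $N$ is not a direct summand in a module from $\mathcal L$. Then $N$ has no $\mathcal L$-precover.
   Context: Modules are right $R$-modules. Bass module: $N$ is a Bass module over $\mathcal F$ if $N$ is the direct limit of a countable direct system $C_0\xrightarrow{f_0}C_1\xrightarrow{f_1}\cdots\to C_n\xrightarrow{f_n}C_{n+1}\to\cdots$ with $C_n\in\mathcal F$ for each $n<\omega$. Filtrations: an $\mathcal F$-filtration of a module $M$ is an ascending chain $(M_\alpha\mid\alpha\le\sigma)$ of submodules of $M$, indexed by the ordinals $\le\sigma$ for some ordinal $\sigma$, with $M_0=0$, $M_\sigma=M$, $M_\beta=\bigcup_{\alpha<\beta}M_\alpha$ for each limit ordinal $\beta\le\sigma$, and each $M_{\alpha+1}/M_\alpha$ ($\alpha<\sigma$) isomorphic to a module from $\mathcal F$. It is countable if $\sigma$ is countable. $\aleph_1$-dense systems: a system $\mathcal S$ of countably presented submodules of $M$ is $\aleph_1$-dense if (1) $\mathcal S$ is closed under unions of well-ordered ascending chains of length $<\aleph_1$, and (2) each countable subset $X\subseteq M$ is contained in some member of $\mathcal S$. Locally free modules: let $\mathcal C$ be the class of all modules possessing a countable $\mathcal F$-filtration. A module $M$ is locally $\mathcal F$-free if $M$ contains an $\aleph_1$-dense system of submodules all of which belong to $\mathcal C$. Precovers: an $\mathcal L$-precover of $N$ is a homomorphism $f:L\to N$ with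 $L\in\mathcal L$ such that each homomorphism $f':L'\to N$ with $L'\in\mathcal L$ factors through $f$. *)

(* Defs.v *)
From HB Require Import structures.
From mathcomp Require Import all_boot all_algebra.
From mathcomp Require Import boolp classical_sets functions cardinality.
From mathcomp Require Import wochoice.

Set Implicit Arguments.
Unset Strict Implicit.
Unset Printing Implicit Defensive.

Import GRing.Theory.
Local Open Scope classical_set_scope.
Local Open Scope ring_scope.

(* MathComp modules are left modules, so a right R-module is a left module
   over the converse ring: for M : rmodType R, a *: x stands for x . a, and
   (a * b) *: x computed in R is b *: (a *: x). *)
Notation rmodType R := (lmodType (R : pzRingType)^c).

Section Modules.
Variable S : pzRingType.

Definition lmod_iso (M N : lmodType S) : Prop :=
  exists f : {linear M -> N}, bijective f.

Section SubmoduleAndQuotient.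
Variable M : lmodType S.

Section Submodule.
Variable A : submodClosed M.

Record submod := Submod { submod_val : M; _ : submod_val \in A }.

HB.instance Definition _ := [isSub for submod_val].
HB.instance Definition _ := [Choice of submod by <:].
HB.instance Definition _ := [SubChoice_isSubLmodule of submod by <:].

End Submodule.

Section Quotient.
Variable A : submodClosed M.

(* A submodClosed is not inferred to be closed under opposites; quot_pred is
   A equipped with that closure property. *)
Definition quot_pred : {pred M} := [pred x | x \in A].

Fact quot_pred_closed : zmod_closed quot_pred.
Proof. exact: GRing.subsemimod_closedB (GRing.subsemimodClosedP A). Qed.
HB.instance Definition _ := GRing.isZmodClosed.Build M quot_pred quot_pred_closed.

Definition quotmod : Type := Quotient.quot quot_pred.
HB.instance Definition _ := GRing.Zmodule.on quotmod.
HB.instance Definition _ := Quotient.on quotmod.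

Local Open Scope quotient_scope.

Definition quotmod_pi (x : M) : quotmod := \pi x.

Definition quotmod_scale (a : S) (x : quotmod) : quotmod :=
  quotmod_pi (a *: repr x).

Fact quotmod_piK (x : quotmod) : quotmod_pi (repr x) = x.
Proof. exact: reprK. Qed.

Fact quotmod_pi_eq (x y : M) : quotmod_pi x = quotmod_pi y <-> x - y \in A.
Proof.
have e : (x - y \in A) = (x == y %[mod quotmod]).
  exact: (Quotient.idealrBE quot_pred x y).
by rewrite e; split=> [xy|/eqP //]; apply/eqP.
Qed.

Fact quotmod_piD (x y : M) : quotmod_pi (x + y) = quotmod_pi x + quotmod_pi y.
Proof. exact: (raddfD (\pi_(Quotient.quot quot_pred))). Qed.

Fact quotmod_piZ a (x : M) :
  quotmod_pi (a *: x) = quotmod_scale a (quotmod_pi x).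
Proof.
apply/quotmod_pi_eq; rewrite -scalerBr; apply: rpredZ.
by apply/quotmod_pi_eq; rewrite quotmod_piK.
Qed.

Fact quotmod_scaleA a b x :
  quotmod_scale a (quotmod_scale b x) = quotmod_scale (a * b) x.
Proof.
by rewrite -(quotmod_piK x); move: (repr x) => y; rewrite -!quotmod_piZ scalerA.
Qed.

Fact quotmod_scale1 : left_id 1 quotmod_scale.
Proof.
move=> x; rewrite -(quotmod_piK x); move: (repr x) => y.
by rewrite -quotmod_piZ scale1r.
Qed.

Fact quotmod_scaleDr : right_distributive quotmod_scale +%R.
Proof.
move=> a x y; rewrite -(quotmod_piK x) -(quotmod_piK y).
move: (repr x) (repr y) => u v.
by rewrite -quotmod_piD -!quotmod_piZ scalerDr quotmod_piD.
Qed.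

Fact quotmod_scaleDl x : {morph quotmod_scale^~ x : a b / a + b}.
Proof.
move=> a b; rewrite -(quotmod_piK x); move: (repr x) => y.
by rewrite -!quotmod_piZ scalerDl quotmod_piD.
Qed.

HB.instance Definition _ := GRing.Zmodule_isLmodule.Build S quotmod
  quotmod_scaleA quotmod_scale1 quotmod_scaleDr quotmod_scaleDl.

End Quotient.

End SubmoduleAndQuotient.

Section Subquotient.
Variables (M : lmodType S) (A B : submodClosed M).

(* The trace A \cap B of A on B, as a submodule of the module B. *)
Definition restr : {pred submod B} := [pred x | val x \in A].

Fact restr_closed : subsemimod_closed restr.
Proof.
split; first by split=> [|x y]; rewrite !inE ?raddf0 ?rpred0 // raddfD; exact: rpredD.
by move=> a x; rewrite !inE linearZ; exact: rpredZ.
Qed.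
HB.instance Definition _ :=
  GRing.isSubmodClosed.Build S (submod B) restr restr_closed.

(* The quotient B / A, used when A is contained in B. *)
Definition subquot : lmodType S := quotmod restr.

End Subquotient.

(* The free module S^(J): finitely supported functions J -> S. *)
Section FreeModule.
Variable J : Type.

Definition finsupp : {pred J -> S^o} :=
  [pred a | `[< finite_set [set j | a j != 0] >]].

Fact finsuppP (a : J -> S^o) :
  reflect (finite_set [set j | a j != 0]) (a \in finsupp).
Proof. exact: asboolP. Qed.

Fact finsupp_closed : subsemimod_closed finsupp.
Proof.
split; first split.
- apply/finsuppP; apply: (@sub_finite_set _ _ set0) => // j /=.
  by rewrite eqxx.
- move=> a b /finsuppP fa /finsuppP fb; apply/finsuppP.
  apply: (@sub_finite_set _ _ ([set j | a j != 0] `|` [set j | b j != 0])).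
    move=> j /= abj; have [aj|] := eqVneq (a j) 0; last by left.
    by right; move: abj; change (a j + b j != 0 -> b j != 0); rewrite aj add0r.
  by rewrite finite_setU.
- move=> c a /finsuppP fa; apply/finsuppP.
  apply: sub_finite_set fa => j /=; apply: contra_neq => aj.
  by change (c *: a j = 0); rewrite aj scaler0.
Qed.
HB.instance Definition _ :=
  GRing.isSubmodClosed.Build S (J -> S^o) finsupp finsupp_closed.

Definition freemod : lmodType S := submod finsupp.

End FreeModule.

(* There is an exact sequence S^(I) -> S^(J) -> M -> 0 with I and J
   countable (possibly finite). *)
Definition countably_presented (M : lmodType S) : Prop :=
  exists (I J : countType)
    (d : {linear freemod I -> freemod J}) (p : {linear freemod J -> M}),
    (forall m, exists x, p x = m) /\
    (forall x, p x = 0 <-> exists y, d y = x).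

Definition is_direct_limit (C : nat -> lmodType S)
    (f : forall n, {linear C n -> C n.+1})
    (N : lmodType S) (g : forall n, {linear C n -> N}) : Prop :=
  (forall n, g n.+1 \o f n =1 g n) /\
  forall (P : lmodType S) (h : forall n, {linear C n -> P}),
    (forall n, h n.+1 \o f n =1 h n) ->
    exists k : {linear N -> P}, (forall n, k \o g n =1 h n) /\
      forall k' : {linear N -> P}, (forall n, k' \o g n =1 h n) -> k' =1 k.

Definition bass_module (F : lmodType S -> Prop) (N : lmodType S) : Prop :=
  exists (C : nat -> lmodType S) (f : forall n, {linear C n -> C n.+1})
    (g : forall n, {linear C n -> N}),
    (forall n, F (C n)) /\ is_direct_limit f g.

Section WellOrder.
Variables (I : Type) (le : rel I).

Definition wlt (i j : I) : Prop := le i j /\ i <> j.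

Definition is_least (i : I) : Prop := forall j, le i j.

Definition is_succ (i j : I) : Prop :=
  wlt i j /\ forall k, wlt i k -> le j k.

Definition is_limit (j : I) : Prop :=
  ~ is_least j /\ ~ exists i, is_succ i j.

End WellOrder.

(* The chain is indexed by a well-ordered type (I, le) with a greatest
   element; such an order is that of the ordinals <= sigma, the greatest
   element standing for sigma and the least one for 0. *)
Record is_filtration (F : lmodType S -> Prop) (M : lmodType S)
    (I : Type) (le : rel I) (A : I -> submodClosed M) : Prop := IsFiltration {
  filt_wo : well_order le;
  filt_chain : forall i j, le i j -> {subset A i <= A j};
  filt_bot : forall i, is_least le i -> forall x, x \in A i <-> x = 0;
  filt_top : exists s, (forall i, le i s) /\ (forall x, x \in A s);
  filt_limit : forall j, is_limit le j ->
    forall x, x \in A j <-> exists i, wlt le i j /\ x \in A i;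
  filt_succ : forall i j, is_succ le i j ->
    exists C, F C /\ lmod_iso (subquot (A i) (A j)) C
}.

(* sigma is countable iff the set of all ordinals <= sigma is. *)
Definition countably_filtered (F : lmodType S -> Prop) (M : lmodType S) : Prop :=
  exists (I : Type) (le : rel I) (A : I -> submodClosed M),
    countable [set: I] /\ is_filtration F le A.

(* Chains are indexed by nonempty countable well-ordered types. *)
Record aleph1_dense (M : lmodType S) (D : set (submodClosed M)) : Prop :=
  Aleph1Dense {
  dense_cp : forall A, D A -> countably_presented (submod A);
  dense_union : forall (I : Type) (le : rel I) (A : I -> submodClosed M),
    well_order le -> countable [set: I] -> [set: I] !=set0 ->
    (forall i j, le i j -> {subset A i <= A j}) ->
    (forall i, D (A i)) ->
    exists U, D U /\ forall x, x \in U <-> exists i, x \in A i;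
  dense_cover : forall X : set M, countable X ->
    exists A, D A /\ forall x, X x -> x \in A
}.

Definition locally_free (F : lmodType S -> Prop) (M : lmodType S) : Prop :=
  exists D : set (submodClosed M), aleph1_dense D /\
    forall A, D A -> countably_filtered F (submod A).

Definition direct_summand (N L : lmodType S) : Prop :=
  exists K : lmodType S, lmod_iso (N * K)%type L.

Definition is_precover (P : lmodType S -> Prop) (N L : lmodType S)
    (f : {linear L -> N}) : Prop :=
  P L /\ forall (L' : lmodType S) (f' : {linear L' -> N}), P L' ->
    exists g : {linear L' -> L}, f' =1 f \o g.

End Modules.

Arguments restr {S M} A B.
Arguments quotmod_pi {S M} A x.

(* Main.v *)
Require Import Defs.
From HB Require Import structures.
From mathcomp Require Import all_boot all_algebra.
From mathcomp Require Import boolp classical_sets functions cardinality fsbigop.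
From mathcomp Require Import wochoice.

Set Implicit Arguments.
Unset Strict Implicit.
Unset Printing Implicit Defensive.

Import GRing.Theory.
Local Open Scope classical_set_scope.
Local Open Scope ring_scope.

(** Write N as the direct limit of C_0 -> C_1 -> ... with transition maps f_n
and canonical maps g_n, and suppose that phi : B -> N is a precover by locally
F-free modules.  A tree module L is built that is locally F-free but maps onto
so many copies of N that lifting all the resulting maps along phi is impossible
unless phi splits; then N is a direct summand of B.

The tree.  Nodes of level n form a set T_n, a branch nu passes through the node
nu|n of T_n, and distinct branches separate for good after finitely many
levels.  L is the module of families p = (p_n(t) in C_n), t a node of level n,
which are supported on finitely many branches and which, along each branch,
satisfy p_(n+1) = f_n(p_n) for large n.  Such a family has along each branch nu
a limit in N, namely g_n(p_n(nu|n)) for large n, and only finitely many of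
these limits are nonzero.  So every set W of branches gives a linear map
[branch_sum W] from L to N, the sum of the limits along the branches in W.

L is locally F-free.  The dense system consists of the submodules of families
supported on the branches beta_0, beta_1, ... of a sequence.  Such a submodule
is a countable direct sum of modules C_n: call (k, n) fresh when the node
beta_k|n lies on no earlier branch; the part of beta_k beyond its first fresh
level contributes one copy of C_n for each fresh (k, n), because a family which
eventually commutes with the f_n is recovered from the finitely many nonzero
defects p_(n+1) - f_n(p_n) ([coord], [tree_dsum]).  Countable direct sums of
countably presented modules from F are countably presented and countably
F-filtered ([dsum_countably_presented], [dsum_filtered]).  The proof is
[tree_locally_free].

The splitting.  Lift each branch_sum W to h_W : L -> B.  If h_W and h_W' agree
on all families concentrated at a single node, and a branch nu belongs to W but
not to W', then h_W - h_W', evaluated on the families that follow nu, induces a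
map N -> B whose composite with phi is the identity ([branch_sum_section]).
The values of h_W on families concentrated at one node form a subset of
(nodes) x H with H large enough to record an element of some C_n and an element
of B.  The tree is chosen so that its branches are exactly these subsets: a node
of level n+1 is a node t of level n together with a subset of T_n x H, and the
branch of a set A reads off A level by level.  The assignment of this subset to
W maps sets of branches to branches, so Cantor's diagonal argument yields W and
W' with the same image nu, where nu lies in W but not in W'
([cantor_diagonal]). *)

(** * Linear maps and dependent products *)

Section LinearMaps.
Variable S : pzRingType.

Section Pack.
Variables (U V : lmodType S) (f : U -> V) (f_lin : linear f).
Definition linear_pack_fun (u : U) : V := f u.
HB.instance Definition _ := GRing.isLinear.Build S U V *:%R linear_pack_fun f_lin.
Definition linear_pack : {linear U -> V} := linear_pack_fun.
End Pack.

Section DependentProduct.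
Variables (I : Type) (V : I -> lmodType S).

Definition dprod : Type := forall i, V i.

HB.instance Definition _ := gen_eqMixin dprod.
HB.instance Definition _ := gen_choiceMixin dprod.

Definition dprod_add (p q : dprod) : dprod := fun i => p i + q i.
Definition dprod_opp (p : dprod) : dprod := fun i => - p i.
Definition dprod_scale a (p : dprod) : dprod := fun i => a *: p i.

Fact dprod_addA : associative dprod_add.
Proof. by move=> p q r; apply: functional_extensionality_dep => i; exact: addrA. Qed.
Fact dprod_addC : commutative dprod_add.
Proof. by move=> p q; apply: functional_extensionality_dep => i; exact: addrC. Qed.
Fact dprod_add0 : left_id (fun=> 0) dprod_add.
Proof. by move=> p; apply: functional_extensionality_dep => i; exact: add0r. Qed.
Fact dprod_addN : left_inverse (fun=> 0) dprod_opp dprod_add.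
Proof. by move=> p; apply: functional_extensionality_dep => i; exact: addNr. Qed.
HB.instance Definition _ :=
  GRing.isZmodule.Build dprod dprod_addA dprod_addC dprod_add0 dprod_addN.

Fact dprod_scaleA a b p : dprod_scale a (dprod_scale b p) = dprod_scale (a * b) p.
Proof. by apply: functional_extensionality_dep => i; exact: scalerA. Qed.
Fact dprod_scale1 : left_id 1 dprod_scale.
Proof. by move=> p; apply: functional_extensionality_dep => i; exact: scale1r. Qed.
Fact dprod_scaleDr : right_distributive dprod_scale +%R.
Proof. by move=> a p q; apply: functional_extensionality_dep => i; exact: scalerDr. Qed.
Fact dprod_scaleDl p : {morph dprod_scale^~ p : a b / a + b}.
Proof. by move=> a b; apply: functional_extensionality_dep => i; exact: scalerDl. Qed.
HB.instance Definition _ := GRing.Zmodule_isLmodule.Build S dprod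
  dprod_scaleA dprod_scale1 dprod_scaleDr dprod_scaleDl.

End DependentProduct.

End LinearMaps.

(** * Direct sums given by coordinate maps *)

Section DirectSum.
Variables (S : pzRingType) (J : choiceType).
Implicit Types (C : J -> lmodType S) (M : lmodType S).

(** The maps k_j exhibit M as the direct sum of the C_j: the induced map from M
to the product is injective with image the finitely supported families.
Describing a direct sum by its projections makes linear maps into M easy to
build, since linearity can be tested on coordinates. *)
Record is_dsum C M (k : forall j, {linear M -> C j}) : Prop := IsDsum {
  dsum_inj : forall m, (forall j, k j m = 0) -> m = 0;
  dsum_supp : forall m, exists s : seq J, forall j, k j m != 0 -> j \in s;
  dsum_glue : forall c : (forall j, C j),
    (exists s : seq J, forall j, c j != 0 -> j \in s) ->
    exists m, forall j, k j m = c j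
}.

Lemma dsum_ext C M (k : forall j, {linear M -> C j}) (Mk : is_dsum k) m m' :
  (forall j, k j m = k j m') -> m = m'.
Proof.
move=> e; apply/eqP; rewrite -subr_eq0; apply/eqP/(dsum_inj Mk) => j.
by rewrite linearB e subrr.
Qed.

Lemma dsum_map C M k C' M' k' (Mk : @is_dsum C M k) (Mk' : @is_dsum C' M' k')
    (phi : forall j, {linear C j -> C' j}) :
  exists Phi : {linear M -> M'}, forall m j, k' j (Phi m) = phi j (k j m).
Proof.
have ex m : exists m', forall j, k' j m' = phi j (k j m).
  apply: (dsum_glue Mk'); have [s ks] := dsum_supp Mk m; exists s => j nz.
  by apply: ks; apply: contra_neq nz => ->; rewrite linear0.
have [F FE] := choice ex.
have F_lin : linear F.
  move=> a u v; apply: (dsum_ext Mk') => j.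
  by rewrite linearP !FE linearP linearP.
by exists (linear_pack F_lin).
Qed.

Definition dirac C (j : J) (x : C j) : forall i, C i := dfwith (fun i => 0 : C i) x.

Lemma dirac_supp C (j : J) (x : C j) i : dirac x i != 0 -> i = j.
Proof. by rewrite /dirac; case: dfwithP => // i' _; rewrite eqxx. Qed.

Lemma dirac_sum C (c : forall j, C j) (s : seq J) (i : J) :
  uniq s -> (c i != 0 -> i \in s) -> \sum_(j <- s) dirac (c j) i = c i.
Proof.
move=> us si; have [js|njs] := boolP (i \in s).
  rewrite (bigD1_seq i) //= /dirac dfwith_in big1 ?addr0 // => j ji.
  by rewrite dfwith_out.
have -> : c i = 0 by apply: contraNeq njs => /si.
rewrite big_seq big1 // => j jin; rewrite /dirac dfwith_out //.
by apply: contraNneq njs => <-.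
Qed.

End DirectSum.

(** * Countable direct sums are countably filtered *)

Section FirstIsomorphism.
Variables (S : pzRingType) (M N : lmodType S) (A : submodClosed M).

Lemma quotmod_iso (h : {linear M -> N}) :
  (forall m, m \in A <-> h m = 0) -> (forall n, exists m, h m = n) ->
  lmod_iso (quotmod A) N.
Proof.
move=> kerh surjh.
have heq (u v : M) : quotmod_pi A u = quotmod_pi A v <-> h u = h v.
  rewrite quotmod_pi_eq kerh linearB.
  by split=> [/eqP|->]; rewrite ?subrr// subr_eq0 => /eqP.
pose h' (q : quotmod A) := h (repr q).
have h'E u : h' (quotmod_pi A u) = h u by apply/heq; exact: quotmod_piK.
have h'_lin : linear h'.
  move=> a p q; rewrite -(quotmod_piK p) -(quotmod_piK q).
  move: (repr p) (repr q) => u v.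
  have -> : a *: quotmod_pi A u + quotmod_pi A v = quotmod_pi A (a *: u + v).
    by rewrite quotmod_piD quotmod_piZ.
  by rewrite !h'E linearP.
exists (linear_pack h'_lin).
have [g gK] := choice surjh.
exists (fun n => quotmod_pi A (g n)) => [q|n].
  by rewrite -[RHS]quotmod_piK; apply/heq; rewrite gK.
by rewrite /= /linear_pack_fun h'E gK.
Qed.

End FirstIsomorphism.

Section CountableFiltration.
Variables (S : pzRingType) (J : countType) (C : J -> lmodType S).
Variables (M : lmodType S) (k : forall j, {linear M -> C j}).
Hypothesis Mk : is_dsum k.

(** Countability of J gives a well-order of type at most omega, to which a top
element is added. *)
Definition otop_le (x y : option J) : bool :=
  match x, y with
  | _, None => true
  | Some i, Some j => (pickle i <= pickle j)%N
  | None, Some _ => false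
  end.

Lemma otop_le_trans : transitive otop_le.
Proof. by move=> [y|] [x|] [z|] //=; exact: leq_trans. Qed.

Lemma otop_le_total : total otop_le.
Proof. by move=> [x|] [y|] //=; exact: leq_total. Qed.

Lemma otop_le_anti : antisymmetric otop_le.
Proof. by move=> [x|] [y|] //= /anti_leq /(pcan_inj pickleK) ->. Qed.

Lemma otop_le_wo : well_order otop_le.
Proof.
apply: antisymmetric_well_order; first exact: otop_le_anti.
move=> A [x Ax].
have [/asboolP [i Ai]|/asboolP nA] := boolP `[< exists i, Some i \in A >].
  have ex : exists n, `[< exists2 i, Some i \in A & pickle i = n >].
    by exists (pickle i); apply/asboolP; exists i.
  case: (ex_minnP ex) => _ /asboolP [m Am <-] min.
  exists (Some m); split=> // -[j|//] Aj /=.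
  by apply: min; apply/asboolP; exists j.
by exists x; split=> // -[j|] Ay; [case: nA; exists j|case: x {Ax}].
Qed.

Lemma wlt_otopE x y : wlt otop_le x y <-> ~~ otop_le y x.
Proof.
split=> [[xy ne]|nyx].
  by apply/negP => yx; apply: ne; apply: otop_le_anti; rewrite xy.
split; first by have := otop_le_total x y; rewrite (negPf nyx) orbF.
by move=> e; move: nyx; rewrite e; have := otop_le_total y y; rewrite orbb => ->.
Qed.

(** The x-th term of the filtration is the sum of the C_i with i < x, described
by the vanishing of the remaining coordinates. *)
Definition below (x : option J) : {pred M} :=
  [pred m | `[< forall i, k i m != 0 -> ~~ otop_le x (Some i) >]].

Lemma belowP x m :
  reflect (forall i, k i m != 0 -> ~~ otop_le x (Some i)) (m \in below x).
Proof. exact: asboolP. Qed.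

Fact below_closed x : subsemimod_closed (below x).
Proof.
split; first split.
- by apply/belowP => i; rewrite linear0 eqxx.
- move=> u v /belowP bu /belowP bv; apply/belowP => i.
  rewrite linearD; have [ui|/bu //] := eqVneq (k i u) 0.
  by rewrite ui add0r => /bv.
- move=> a u /belowP bu; apply/belowP => i.
  by rewrite linearZ /=; have [->|/bu //] := eqVneq (k i u) 0; rewrite scaler0 eqxx.
Qed.
HB.instance Definition _ x :=
  GRing.isSubmodClosed.Build S M (below x) (below_closed x).

(** An element has finite support, and below a limit any finite set of indices
has a strict upper bound. *)
Lemma below_limit x m : is_limit otop_le x ->
  m \in below x -> exists y, wlt otop_le y x /\ m \in below y.
Proof.
move=> [nleast nsucc] /belowP bm; have [s sm] := dsum_supp Mk m.
suff [y yx sy] : exists2 y, wlt otop_le y x &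
    forall i, i \in s -> k i m != 0 -> ~~ otop_le y (Some i).
  by exists y; split=> //; apply/belowP => i nz; exact: sy (sm _ nz) nz.
elim: s {sm} => [|i s [y yx IHs]].
  by have [y /negP/wlt_otopE yx] := (existsNP _).2 nleast; exists y.
have [mi0|mi] := eqVneq (k i m) 0.
  exists y => // j; rewrite inE => /orP[/eqP->|/IHs//].
  by rewrite mi0 eqxx.
have [z [iz zx]] : exists z, wlt otop_le (Some i) z /\ wlt otop_le z x.
  apply/not_existsP => nz; apply: nsucc; exists (Some i).
  split=> [|z iz]; first exact/wlt_otopE/bm.
  by apply/negPn/negP => /wlt_otopE zx; exact: (nz z).
have [yz|zy] := orP (otop_le_total y z).
  exists z => // j; rewrite inE => /orP[/eqP-> _|js mj].
    exact/wlt_otopE.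
  by apply: contra (IHs _ js mj); exact: otop_le_trans.
exists y => // j; rewrite inE => /orP[/eqP-> _|/IHs//].
by move/wlt_otopE: iz; apply: contra; exact: otop_le_trans.
Qed.

(** The j-th coordinate is onto C_j, and its kernel on the successor term is the
term at j. *)
Lemma below_succ x y : is_succ otop_le x y ->
  exists j, lmod_iso (subquot (below x) (below y)) (C j).
Proof.
case: x => [j|] [xy succ]; last by case/wlt_otopE/negP: xy; case: (y).
exists j.
have h_lin : linear (fun u : submod (below y) => k j (val u)).
  by move=> a u v; rewrite !linearP.
apply: (@quotmod_iso _ _ _ _ (linear_pack h_lin)) => [u|c].
  rewrite /= /linear_pack_fun; split=> [/belowP bu|ju0].
    by apply/eqP/negPn/negP => /bu /=; rewrite leqnn.
  have/belowP bu := valP u; apply/belowP => i nz.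
  apply/negP => ji; have /negP := bu _ nz; apply.
  apply: succ; split=> // -[e]; move: nz.
  by rewrite -e ju0 eqxx.
have [|m mE] := dsum_glue Mk (c := dirac c).
  by exists [:: j] => i /dirac_supp ->; rewrite mem_head.
have bm : m \in below y.
  apply/belowP => i; rewrite mE => /dirac_supp ->; exact/wlt_otopE.
by exists (Submod bm); rewrite /= /linear_pack_fun /= mE /dirac dfwith_in.
Qed.

Lemma dsum_filtered (F : lmodType S -> Prop) :
  (forall j, F (C j)) -> countably_filtered F M.
Proof.
move=> FC; exists (option J), otop_le, (fun x => below x : submodClosed M); split.
  exact: countableP.
have below_mono x y : otop_le x y -> {subset below x <= below y}.
  move=> xy m /belowP bm; apply/belowP => i /bm.
  by apply: contra; exact: otop_le_trans.
split.
- exact: otop_le_wo.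
- exact: below_mono.
- move=> x least m; split=> [/belowP bm|->]; last exact: (rpred0 (below x)).
  apply: (dsum_inj Mk) => j; apply/eqP/negPn/negP => /bm.
  by rewrite least.
- by exists None; split=> [[]//|m]; apply/belowP.
- move=> x limx m; split=> [|[y [[yx _]]]]; first exact: below_limit.
  exact: below_mono yx m.
- by move=> x y /below_succ [j jiso]; exists (C j).
Qed.
End CountableFiltration.

(** * Countable direct sums are countably presented *)

Section CountablePresentation.
Variables (S : pzRingType) (J : choiceType) (I : J -> Type).

Lemma slice_subproof j (a : freemod S {j & I j}) :
  (fun i => val a (existT I j i)) \in @finsupp S (I j).
Proof.
have /finsuppP fa := valP a; apply/finsuppP.
apply: (@sub_finite_set _ _ (existT I j @^-1` [set x | val a x != 0])) => //.
apply: finite_preimage fa => x y _ _ e.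
exact: eq_from_Tagged e.
Qed.

Definition slice_fun j (a : freemod S {j & I j}) : freemod S (I j) :=
  Submod (slice_subproof j a).

Lemma slice_linear j : linear (@slice_fun j).
Proof. by move=> c a b; apply: val_inj. Qed.

Definition slice j : {linear freemod S {j & I j} -> freemod S (I j)} :=
  linear_pack (@slice_linear j).

(** A free module on a disjoint union is the direct sum of the free modules on
the pieces. *)
Lemma freemod_dsum : is_dsum slice.
Proof.
split.
- move=> a a0; apply: val_inj; apply: funext => -[j i].
  by have /(congr1 (fun b : freemod S (I j) => val b i)) := a0 j.
- move=> a; have /finsuppP fa := valP a.
  have [s sE] := (finite_seqP _).1 (finite_image (@tag J I) fa).
  exists s => j nz; suff: [set` s] j by [].
  rewrite -sE; apply: contrapT => na; move/eqP: nz; apply.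
  apply: val_inj; apply: funext => i /=; apply/eqP/negPn/negP => ai.
  by apply: na; exists (existT I j i).
- move=> c [s cs].
  pose a (x : {j & I j}) : S^o := val (c (tag x)) (tagged x).
  have fa : a \in @finsupp S {j & I j}.
    apply/finsuppP; apply: (@sub_finite_set _ _ (\bigcup_(j in [set` s])
      [set existT I j i | i in [set i | val (c j) i != 0]])).
      move=> [j i] /= nz; exists j; last by exists i.
      by apply: cs; apply: contra_neq nz => c0; rewrite /a /= c0.
    apply: bigcup_finite => [|j _]; first exact: finite_seq.
    by apply: finite_image; apply/finsuppP; exact: valP (c j).
  by exists (Submod fa) => j; apply: val_inj.
Qed.

End CountablePresentation.

(** The direct sum of the presentations of the C_j is a presentation of M;
exactness is checked coordinatewise. *)
Lemma dsum_countably_presented (S : pzRingType) (J : countType)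
    (C : J -> lmodType S) (M : lmodType S) (k : forall j, {linear M -> C j}) :
  is_dsum k -> (forall j, countably_presented (C j)) -> countably_presented M.
Proof.
move=> Mk Ccp.
have pres j : {I : countType & {K : countType &
    {d : {linear freemod S I -> freemod S K} & {p : {linear freemod S K -> C j} |
      (forall c, exists x, p x = c) /\ (forall x, p x = 0 <-> exists y, d y = x)}}}}.
  have [I /cid[K /cid[d /cid[p dp]]]] := cid (Ccp j).
  by exists I, K, d, p.
pose I j := projT1 (pres j); pose K j := projT1 (projT2 (pres j)).
pose d j : {linear freemod S (I j) -> freemod S (K j)} :=
  projT1 (projT2 (projT2 (pres j))).
pose p j : {linear freemod S (K j) -> C j} :=
  projT1 (projT2 (projT2 (projT2 (pres j)))).
have p_surj j c : exists x, p j x = c.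
  exact: (projT2 (projT2 (projT2 (projT2 (pres j))))).1.
have p_ker j x : p j x = 0 <-> exists y, d j y = x.
  exact: (projT2 (projT2 (projT2 (projT2 (pres j))))).2.
move: I K d p p_surj p_ker => I K d p p_surj p_ker {pres}.
have [D DE] := dsum_map (freemod_dsum S I) (freemod_dsum S K) d.
have [P PE] := dsum_map (freemod_dsum S K) Mk p.
(* Finitely supported families lift along coordinatewise surjections: where the
   target vanishes the lift is taken to be 0, to keep the support finite. *)
have lift (X : J -> Type) (L : forall j, lmodType S)
    (q : forall j, {linear freemod S (X j) -> L j}) (l : forall j, L j) :
    (exists s : seq J, forall j, l j != 0 -> j \in s) ->
    (forall j, exists x, q j x = l j) ->
    exists x, forall j, q j (@slice S J X j x) = l j.
  move=> [s ls] ql.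
  have ql0 j : exists x, q j x = l j /\ (l j = 0 -> x = 0).
    have [l0|nz] := eqVneq (l j) 0; first by exists 0; rewrite linear0 l0.
    by have [x qx] := ql j; exists x; split=> // l0; rewrite l0 eqxx in nz.
  pose x j := projT1 (cid (ql0 j)).
  have [|y yE] := dsum_glue (freemod_dsum S X) (c := x).
    exists s => j nz; apply: ls; apply: contra_neq nz.
    exact: (projT2 (cid (ql0 j))).2.
  by exists y => j; rewrite yE; exact: (projT2 (cid (ql0 j))).1.
exists {j & I j}, {j & K j}, D, P; split=> [m|x].
  have [x xE] := lift _ _ p (fun j => k j m) (dsum_supp Mk m) (fun j => p_surj j _).
  by exists x; apply: (dsum_ext Mk) => j; rewrite PE.
split=> [Px0|[y <-]].
  have [|y yE] := lift _ _ d (fun j => @slice S J K j x) (dsum_supp (freemod_dsum S K) x).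
    by move=> j; apply/p_ker; rewrite -PE Px0 linear0.
  by exists y; apply: (dsum_ext (freemod_dsum S K)) => j; rewrite DE.
apply: (dsum_inj Mk) => j; rewrite PE DE; apply/p_ker; by eexists.
Qed.

(** * Threads and tree modules *)

Lemma well_order_total (I : Type) (le : rel I) :
  well_order le -> forall i j, le i j \/ le j i.
Proof.
move=> wo i j; have [|z [[]]] := wo [pred z | `[< z = i \/ z = j >]].
  by exists i; apply/asboolP; left.
move=> /asboolP zij lb _; have := lb i (introT (asboolP _) (or_introl erefl)).
have := lb j (introT (asboolP _) (or_intror erefl)).
by case: zij => ->; [left|right].
Qed.

Lemma countable_rangeP (X : Type) (W : set X) :
  countable W -> W !=set0 -> exists b : nat -> X, W = range b.
Proof.
move=> /pfcard_geP[->[]//|[g] _].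
by exists g; apply/esym; exact: image_eq.
Qed.

Section TreeModule.
Variables (S : pzRingType) (C : nat -> lmodType S).
Variable f : forall n, {linear C n -> C n.+1}.
Variables (T : nat -> Type) (Br : choiceType) (res : Br -> forall n, T n).
Hypothesis res_down : forall nu mu n,
  res nu n.+1 = res mu n.+1 -> res nu n = res mu n.
Hypothesis res_sep : forall nu mu, (forall n, res nu n = res mu n) -> nu = mu.

Lemma res_le nu mu m n :
  (m <= n)%N -> res nu n = res mu n -> res nu m = res mu m.
Proof.
by move=> /subnK <-; elim: (n - m)%N => // d IHd /res_down/IHd.
Qed.

Lemma res_neq nu mu : nu <> mu ->
  exists m, forall n, (m <= n)%N -> res nu n <> res mu n.
Proof.
move=> ne; have [m nem] : exists m, res nu m <> res mu m.
  by apply/existsNP => e; apply: ne; exact: res_sep.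
by exists m => n /res_le mn /mn.
Qed.

(** The sequence that starts with x at n and follows f from there.  Taking the
values up to n from the dirac family avoids transporting x along an equality of
indices. *)
Definition thread_at n (x : C n) : forall i, C i :=
  fix thread i := match i with
  | 0 => @dirac S nat C n x 0
  | i.+1 => if (n <= i)%N then f i (thread i) else @dirac S nat C n x i.+1
  end.

Lemma thread_atS n (x : C n) i :
  (n <= i)%N -> thread_at x i.+1 = f i (thread_at x i).
Proof. by move=> /= ->. Qed.

Lemma thread_at_lt n (x : C n) i : (i < n)%N -> thread_at x i = 0.
Proof.
case: i => [|i] ni /=; last first; [rewrite leqNgt (ltnW ni) /=|].
  by rewrite /dirac dfwith_out // gtn_eqF.
by rewrite /dirac dfwith_out // gtn_eqF.
Qed.

Lemma thread_at_id n (x : C n) : thread_at x n = x.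
Proof.
by case: n x => [|n] x /=; rewrite ?ltnn /dirac dfwith_in.
Qed.

Lemma thread_at_linear n i a (x y : C n) :
  thread_at (a *: x + y) i = a *: thread_at x i + thread_at y i.
Proof.
have [|] := ltnP i n; first by move=> ni; rewrite !thread_at_lt // scaler0 addr0.
move=> /subnK <-; elim: (i - n)%N => [|d IHd].
  by rewrite !add0n !thread_at_id.
by rewrite addSn !thread_atS ?leq_addl // IHd linearP.
Qed.

(** By this identity a map that vanishes on sequences concentrated at one level
takes the same value on the threads of x and of f x, and so factors through the
direct limit. *)
Lemma thread_at_next n (x : C n) i :
  thread_at x i = @dirac S nat C n x i + thread_at (f n x) i.
Proof.
have dn j : j != n -> @dirac S nat C n x j = 0.
  by move=> jn; rewrite /dirac dfwith_out // eq_sym.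
have [ni|] := ltnP i n.
  by rewrite !thread_at_lt ?dn ?addr0 ?(ltn_eqF ni) // ltnW.
rewrite leq_eqVlt => /orP[/eqP <-|].
  by rewrite thread_at_id thread_at_lt // addr0 /dirac dfwith_in.
move=> ni; rewrite dn ?gtn_eqF // add0r; move: ni => /subnK <-.
elim: (i - n.+1)%N => [|d IHd].
  by rewrite add0n thread_atS // !thread_at_id.
rewrite addSn thread_atS ?(leq_trans (leqnSn n)) ?leq_addl // IHd.
by rewrite thread_atS // leq_addl.
Qed.

(** Families indexed by all nodes: the value at a node of level n is in C n. *)
Definition node_prod : lmodType S := dprod (fun n => (T n -> C n) : lmodType S).

Definition supported (l : seq Br) (p : node_prod) : Prop :=
  forall n t, p n t != 0 -> exists2 nu, nu \in l & res nu n = t.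

Definition eventual_thread (s : forall n, C n) : Prop :=
  exists m, forall n, (m <= n)%N -> s n.+1 = f n (s n).

(** The coherence condition ranges over all branches, including those outside
the support, so that it is stable under sums of families with different
supports. *)
Definition tree (W : set Br) : {pred node_prod} :=
  [pred p : node_prod | `[< (exists2 l, (forall nu, nu \in l -> W nu) & supported l p) /\
    forall nu, eventual_thread (fun n => p n (res nu n)) >] ].

Lemma treeP W p : reflect
  ((exists2 l, (forall nu, nu \in l -> W nu) & supported l p) /\
    forall nu, eventual_thread (fun n => p n (res nu n))) (p \in tree W).
Proof. exact: asboolP. Qed.

Lemma eventual_thread_lin a s s' : eventual_thread s -> eventual_thread s' ->
  eventual_thread (fun n => a *: s n + s' n).
Proof.
move=> [m sm] [m' sm']; exists (maxn m m') => n; rewrite geq_max => /andP[mn mn'].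
by rewrite sm // sm' // linearP.
Qed.

Lemma eventual_thread0 s m : (forall n, (m <= n)%N -> s n = 0) -> eventual_thread s.
Proof.
by move=> s0; exists m => n mn; rewrite !s0 ?linear0 // (leq_trans mn).
Qed.

Lemma supported_lin l l' a p q : supported l p -> supported l' q ->
  supported (l ++ l') (a *: p + q).
Proof.
move=> lp lq n t; change ((a *: p + q) n t) with (a *: (p n t) + q n t).
have [p0|/lp[nu ln e] _] := eqVneq (p n t) 0.
  rewrite p0 scaler0 add0r => /lq[nu ln e].
  by exists nu; rewrite // mem_cat ln orbT.
by exists nu; rewrite // mem_cat ln.
Qed.

Fact tree_closed W : subsemimod_closed (tree W).
Proof.
have t0 : 0 \in tree W.
  apply/treeP; split; first by exists [::] => // n t /=; rewrite eqxx.
  by move=> nu; apply: (@eventual_thread0 _ 0).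
have tL a p q : p \in tree W -> q \in tree W -> a *: p + q \in tree W.
  move=> /treeP[[l lW lp] pt] /treeP[[l' lW' lq] qt]; apply/treeP; split.
    exists (l ++ l'); last exact: supported_lin.
    by move=> nu; rewrite mem_cat => /orP[/lW|/lW'].
  by move=> nu; exact: eventual_thread_lin.
split; first split=> // p q pt qt; first by rewrite -[p]scale1r tL.
by move=> a p pt; rewrite -[_ *: _]addr0 tL.
Qed.
HB.instance Definition _ W :=
  GRing.isSubmodClosed.Build S node_prod (tree W) (tree_closed W).

Lemma tree_sub W W' : W `<=` W' -> {subset tree W <= tree W'}.
Proof.
move=> WW' p /treeP[[l lW lp] pt]; apply/treeP; split=> //.
by exists l => // nu /lW/WW'.
Qed.

Definition line nu (s : forall n, C n) : node_prod :=
  fun n t => if `[< t = res nu n >] then s n else 0.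
Arguments line : clear implicits.

Lemma line_on nu s n : line nu s n (res nu n) = s n.
Proof. by rewrite /line; case: asboolP. Qed.

Lemma line_off nu s n t : t <> res nu n -> line nu s n t = 0.
Proof. by rewrite /line; case: asboolP. Qed.

Lemma line_in_tree (W : set Br) nu s : W nu -> eventual_thread s -> line nu s \in tree W.
Proof.
move=> Wnu st; apply/treeP; split.
  exists [:: nu] => [mu /[!inE]/eqP->//|n t nz].
  exists nu; first exact: mem_head.
  by apply: contrapT => ne; move/eqP: nz; apply; apply: line_off => e; exact: ne.
move=> mu; have [->|/eqP ne] := eqVneq mu nu.
  by case: st => m sm; exists m => n mn; rewrite !line_on sm.
have [m mne] := res_neq ne; apply: (@eventual_thread0 _ m) => n mn.
by rewrite line_off //; exact: mne.
Qed.

(** Removing from p its values along one supporting branch leaves a family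
supported on the remaining ones, so tree W is the sum of its lines. *)
Lemma tree_ind W (Q : node_prod -> Prop) :
  Q 0 -> (forall p q, Q p -> Q q -> Q (p + q)) ->
  (forall nu s, W nu -> eventual_thread s -> Q (line nu s)) ->
  forall p, p \in tree W -> Q p.
Proof.
move=> Q0 QD Ql p /treeP[[l]]; elim: l p => [|nu l IHl] p lW lp pt.
  suff -> : p = 0 by [].
  apply: functional_extensionality_dep => n; apply: funext => t.
  by apply/eqP/negPn/negP => /lp[].
pose s n := p n (res nu n).
rewrite -[p](subrK (line nu s)); apply: QD; last first.
  by apply: Ql; [exact/lW/mem_head|exact: pt].
have st mu : eventual_thread (fun n => line nu s n (res mu n)).
  suff /treeP[_ st] : line nu s \in tree [set nu] by exact: st.
  by apply: line_in_tree => //; exact: pt.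
apply: IHl => [mu mul||mu].
- by apply: lW; rewrite inE mul orbT.
- move=> n t; change ((p - line nu s) n t) with (p n t - line nu s n t).
  have [->|ne] := pselect (t = res nu n); first by rewrite line_on subrr eqxx.
  rewrite line_off // subr0 => /lp[mu]; rewrite inE => /orP[/eqP->|] //.
    by move=> e; case: ne.
  by move=> mul e; exists mu.
- have [m pm] := eventual_thread_lin (-1) (st mu) (pt mu); exists m => n /pm.
  change ((p - line nu s) n) with (p n - line nu s n).
  by rewrite !scaleN1r ![- _ + _]addrC.
Qed.

(** * Coordinates on the tree over a sequence of branches *)

Section Enumerated.
Variable beta : nat -> Br.

(** Freshness is inherited by higher levels, and fresh nodes of different
branches are different; a repetition of an earlier branch has no fresh node, so beta
need not be injective. *)
Definition fresh k n : Prop := forall j, (j < k)%N -> res (beta j) n <> res (beta k) n.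

Lemma fresh_le k m n : (m <= n)%N -> fresh k m -> fresh k n.
Proof. by move=> mn km j jk /(res_le mn); exact: km. Qed.

Lemma fresh_neq k k' n : fresh k n -> fresh k' n -> k != k' ->
  res (beta k) n <> res (beta k') n.
Proof.
move=> kn k'n; rewrite neq_ltn => /orP[/k'n//|/kn ne e]; exact: ne.
Qed.

Lemma fresh_ex k n : exists2 j, fresh j n & res (beta j) n = res (beta k) n.
Proof.
have ex : exists j, `[< res (beta j) n = res (beta k) n >] by exists k; apply/asboolP.
case: (ex_minnP ex) => j /asboolP e min; exists j => // i ij ei.
by have := min i; rewrite ei e leqNgt ij => /(_ (introT (asboolP _) erefl)).
Qed.

Definition fresh_node : countType := {kn : nat * nat | `[< fresh kn.1 kn.2 >]}.

(** The defect of p along beta k at level n.  Below the first fresh level the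
values belong to an earlier branch and are left out, as if they were 0. *)
Definition coord k n (p : node_prod) : C n :=
  p n (res (beta k) n) -
  match n return C n with
  | 0 => 0
  | m.+1 => if `[< fresh k m >] then f m (p m (res (beta k) m)) else 0
  end.

Lemma coord_linear k n : linear (@coord k n).
Proof.
move=> a p q; rewrite /coord.
change ((a *: p + q) n (res (beta k) n))
  with (a *: p n (res (beta k) n) + q n (res (beta k) n)).
case: n => [|n]; first by rewrite !subr0.
case: asboolP => [_|_]; last by rewrite !subr0.
change ((a *: p + q) n (res (beta k) n))
  with (a *: p n (res (beta k) n) + q n (res (beta k) n)).
by rewrite linearP scalerBr opprD addrACA.
Qed.

Lemma coord0 k n p : fresh k n ->
  (forall n, fresh k n -> coord k n p = 0) -> p n (res (beta k) n) = 0.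
Proof.
move=> kn c0; elim: n kn => [|n IHn] kn; have := c0 _ kn; rewrite /coord.
  by rewrite subr0.
by case: asboolP => [/IHn ->|_]; rewrite ?linear0 ?subr0 ?addr0.
Qed.

(** Threads at fresh nodes form the dual family of the coordinates. *)
Lemma coord_line (j i : fresh_node) (x : C (val j).2) :
  coord (val i).1 (val i).2 (line (beta (val j).1) (thread_at x)) =
  @dirac S fresh_node (fun j => C (val j).2) j x i.
Proof.
have [e|ne] := eqVneq j i.
  subst i; rewrite /dirac dfwith_in; case: j x => -[k [|n]] /= kn x.
    by rewrite /coord line_on thread_at_id /= subr0.
  rewrite /coord !line_on thread_at_id thread_at_lt // linear0.
  by case: ifP; rewrite ?subr0 ?addr0.
rewrite /dirac dfwith_out //.
have /asboolP kn := valP j; have /asboolP k'n' := valP i.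
have {}ne : val j != val i by apply: contra_neq ne; exact: val_inj.
case: (val j) (val i) kn k'n' x ne => [k n] [k' n'] /= kn k'n' x ne.
have [e|nek] := eqVneq k k'; last first.
  have off m : fresh k' m -> line (beta k) (thread_at x) m (res (beta k') m) = 0.
    move=> k'm; have [mn|nm] := ltnP m n.
      by rewrite /line; case: ifP => // _; rewrite thread_at_lt.
    by rewrite line_off //; apply: fresh_neq; rewrite 1?eq_sym //; exact: fresh_le kn.
  rewrite /coord off //; case: n' {ne k'n'} => [|n']; rewrite ?subr0 //.
  by case: asboolP => [/off->|]; rewrite ?linear0 ?subr0 ?addr0.
subst k'; have ne' : n != n' by apply: contraNneq ne => ->.
case: n' ne' {ne} k'n' => [|n'] ne k'n'.
  by rewrite /coord line_on subr0 thread_at_lt // lt0n.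
rewrite /coord !line_on; have [lt|] := ltnP n'.+1 n.
  by rewrite !thread_at_lt // 1?ltnW // linear0; case: ifP; rewrite ?subr0 ?addr0.
rewrite leq_eqVlt (negPf ne) orFb ltnS => le.
by case: asboolP => [_|[]]; [rewrite thread_atS // subrr|exact: fresh_le kn].
Qed.

(** If beta_0, ..., beta_K contain the support of p, then a node of beta_k with
k > K that is fresh is outside the support, and along each of beta_0, ...,
beta_K the defects vanish eventually. *)
Lemma coord_supp p : p \in tree (range beta) ->
  exists s : seq fresh_node, forall j, coord (val j).1 (val j).2 p != 0 -> j \in s.
Proof.
move=> /treeP[[l lb lp] pt].
have [K Kl] : exists K, forall nu, nu \in l -> exists2 k, (k <= K)%N & beta k = nu.
  elim: l lb {lp} => [|nu l IHl] lb; first by exists 0%N.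
  have [k _ e] := lb nu (mem_head _ _).
  have [|K HK] := IHl; first by move=> mu mul; apply: lb; rewrite inE mul orbT.
  exists (maxn k K) => mu; rewrite inE => /orP[/eqP->|/HK[k' k'K e']].
    by exists k => //; exact: leq_maxl.
  by exists k' => //; rewrite leq_max k'K orbT.
have on k n : fresh k n -> p n (res (beta k) n) != 0 -> (k <= K)%N.
  move=> kn /lp[nu /Kl[k' k'K <-] e]; apply: leq_trans k'K.
  by rewrite leqNgt; apply/negP => /kn.
have kK k n : fresh k n -> coord k n p != 0 -> (k <= K)%N.
  move=> kn; have [p0|nz _] := eqVneq (p n (res (beta k) n)) 0; last exact: on nz.
  rewrite /coord p0; case: n {kn p0} => [|n]; first by rewrite subrr eqxx.
  case: asboolP => [kn|]; last by rewrite subrr eqxx.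
  have [->|nz _] := eqVneq (p n (res (beta k) n)) 0; last exact: on nz.
  by rewrite ?linear0 ?subrr ?addr0 eqxx.
have bound k : exists b, forall n, fresh k n -> coord k n p != 0 -> (n <= b)%N.
  have [m pm] := pt (beta k).
  have [[n0 kn0]|nf] := pselect (exists n, fresh k n); last first.
    by exists 0%N => n kn; case: nf; exists n.
  (* Beyond n0 the previous level is fresh too, so the coordinate is a defect. *)
  exists (maxn m n0) => n kn; apply: contraNT; rewrite -ltnNge gtn_max.
  case: n kn => // n kn; rewrite !ltnS => /andP[mn n0n].
  by rewrite /coord; case: asboolP => [_|[]]; [rewrite pm // subrr|exact: fresh_le kn0].
have [b Hb] := choice bound.
exists (pmap insub [seq (k, n) | k <- iota 0 K.+1, n <- iota 0 (b k).+1]).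
move=> j nz; rewrite mem_pmap_sub; have /asboolP fj := valP j.
case: (val j) fj nz => k n kn nz.
by apply/allpairsPdep; exists k, n; split=> //; rewrite mem_iota ltnS;
  [exact: kK nz|exact: Hb].
Qed.

(* The module is only required to be isomorphic to tree (range beta), since
   that set occurs as a submodule of the tree module rather than of the
   product. *)
Section Parametrized.
Variables (M : lmodType S) (v : {linear M -> node_prod}).
Hypotheses (v_inj : injective v)
  (v_im : forall p, p \in tree (range beta) <-> exists m, v m = p).

Lemma node_coord_linear (j : fresh_node) :
  linear (fun m : M => coord (val j).1 (val j).2 (v m)).
Proof. by move=> a m m'; rewrite linearP coord_linear. Qed.

Lemma tree_dsum : is_dsum (fun j => linear_pack (node_coord_linear j)).
Proof.
split=> [m c0|m|c [s cs]].
- apply: v_inj; rewrite linear0.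
  have /treeP[[l lb lp] _] : v m \in tree (range beta) by apply/v_im; exists m.
  apply: functional_extensionality_dep => n; apply: funext => t.
  apply/eqP/negPn/negP => nz; have [nu /lb[k _ <-] e] := lp _ _ nz.
  move/eqP: nz; apply; rewrite -e; have [j jn <-] := fresh_ex k n.
  apply: coord0 => // n' jn'.
  exact: (c0 (exist _ (j, n') (introT (asboolP _) jn'))).
- by apply: coord_supp; apply/v_im; exists m.
- pose b (j : fresh_node) := line (beta (val j).1) (thread_at (c j)).
  have bt j : b j \in tree (range beta).
    apply: line_in_tree; first by exists (val j).1.
    by exists (val j).2 => n; exact: thread_atS.
  have [m mE] : exists m, v m = \sum_(j <- undup s) b j.
    by apply/v_im; apply: rpred_sum => j _.
  exists m => i; rewrite /= /linear_pack_fun mE.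
  rewrite -(dirac_sum (s := undup s) (i := i)) ?undup_uniq //; last first.
    by rewrite mem_undup; exact: cs.
  have := raddf_sum (linear_pack (@coord_linear (val i).1 (val i).2)) (undup s) xpredT b.
  rewrite /= /linear_pack_fun => ->.
  by apply: eq_bigr => j _; exact: coord_line.
Qed.

End Parametrized.
End Enumerated.

(** * The tree module is locally free *)

Definition tree_module : lmodType S := submod (tree setT).

Section LocallyFree.
Variables (F : lmodType S -> Prop).
Hypothesis F_cp : forall M, F M -> countably_presented M.
Hypothesis FC : forall n, F (C n).

Lemma enumerated_tree_free (beta : nat -> Br) :
  countably_presented (submod (restr (tree (range beta)) (tree setT))) /\
  countably_filtered F (submod (restr (tree (range beta)) (tree setT))).
Proof.
have v_lin : linear (fun m : submod (restr (tree (range beta)) (tree setT)) =>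
    val (val m) : node_prod) by move=> a u w; rewrite !linearP.
have v_inj : injective (linear_pack v_lin) by move=> u w /val_inj/val_inj.
have v_im p : p \in tree (range beta) <-> exists m, linear_pack v_lin m = p.
  split=> [pt|[m <-]]; last exact: (valP m).
  have pT : p \in tree setT by apply: tree_sub pt.
  by exists (Submod (pt : (Submod pT) \in restr (tree (range beta)) (tree setT))).
have D := tree_dsum v_inj v_im.
split; first by apply: (dsum_countably_presented D) => j; exact/F_cp/FC.
by apply: (dsum_filtered D) => j; exact: FC.
Qed.

(** The dense system is that of the trees over sequences of branches.  The
union of a chain of such trees is the tree over the union of their branch sets:
by [tree_ind] only lines and sums have to be considered, and two members of a
chain lie in the larger one.  The branch nu0 is there to cover the empty set. *)
Lemma tree_locally_free (nu0 : Br) : locally_free F tree_module.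
Proof.
pose sub (beta : nat -> Br) : submodClosed tree_module :=
  restr (tree (range beta)) (tree setT).
have in_sub beta x : (x \in sub beta) = (val x \in tree (range beta)) by [].
exists [set A | exists beta : nat -> Br, A = sub beta].
split; last by move=> _ [beta ->]; exact: (enumerated_tree_free beta).2.
split.
- by move=> _ [beta ->]; exact: (enumerated_tree_free beta).1.
- move=> I le A wo cI [i0 _] chainA DA.
  have [beta betaE] := choice DA.
  have cW : countable (\bigcup_i range (beta i)).
    by apply: bigcup_countable => // i _; exact: card_image_le.
  have [|b bE] := countable_rangeP cW.
    by exists (beta i0 0%N), i0 => //; exists 0%N.
  exists (sub b); split; first by exists b.
  have inA i p (pT : p \in tree setT) :
      (Submod pT \in A i) = (p \in tree (range (beta i))) by rewrite betaE in_sub.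
  move=> [p pT]; split=> [pb|[i]]; last first.
    rewrite inA => pi; rewrite in_sub -bE; apply: tree_sub pi.
    by move=> nu ni; exists i.
  suff [i pi] : exists i, p \in tree (range (beta i)) by exists i; rewrite inA.
  have : p \in tree (\bigcup_i range (beta i)) by rewrite bE -(in_sub _ (Submod pT)).
  apply: (@tree_ind _ (fun p => exists i, p \in tree (range (beta i)))).
  + by exists i0; exact: rpred0.
  + move=> q r [i qi] [j rj].
    have sub_le i' j' : le i' j' ->
        {subset tree (range (beta i')) <= tree (range (beta j'))}.
      move=> ij u ui; have uT : u \in tree setT by apply: tree_sub ui.
      by rewrite -(inA j' u uT); apply: (chainA _ _ ij); rewrite inA.
    have [ij|ji] := well_order_total wo i j.
      by exists j; apply: rpredD => //; exact: sub_le qi.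
    by exists i; apply: rpredD => //; exact: sub_le rj.
  + by move=> nu s [i _ ni] st; exists i; exact: line_in_tree.
- move=> X cX.
  have Xl (x : tree_module) : exists l : seq Br, supported l (val x).
    by have /treeP[[l _ xl] _] := valP x; exists l.
  have [l lx] := choice Xl.
  have [[x0 Xx0]|X0] := pselect (X !=set0); last first.
    exists (sub (fun=> nu0)); split; first by exists (fun=> nu0).
    by move=> x Xx; case: X0; exists x.
  have cW : countable (\bigcup_(x in X) [set` nu0 :: l x]).
    by apply: bigcup_countable => // x _; exact/finite_set_countable/finite_seq.
  have [|b bE] := countable_rangeP cW; first by exists nu0, x0 => //=; rewrite mem_head.
  exists (sub b); split; first by exists b.
  move=> x Xx; rewrite in_sub -bE; apply/treeP; split.
    by exists (l x) => // nu nl; exists x; rewrite //= inE nl orbT.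
  by have /treeP[] := valP x.
Qed.

End LocallyFree.

(** * Sums of limits along branches *)

Section BranchSums.
Variables (N : lmodType S) (g : forall n, {linear C n -> N}).
Hypothesis Ncolim : is_direct_limit f g.

Let g_comp := Ncolim.1.

Definition thread_lim (s : forall n, C n) : N :=
  if pselect (eventual_thread s) is left st then
    let m := projT1 (cid st) in g m (s m)
  else 0.

Lemma thread_limE s m : (forall n, (m <= n)%N -> s n.+1 = f n (s n)) ->
  forall n, (m <= n)%N -> thread_lim s = g n (s n).
Proof.
have step k : (forall n, (k <= n)%N -> s n.+1 = f n (s n)) ->
    forall n, (k <= n)%N -> g k (s k) = g n (s n).
  move=> sk n /subnK <-; elim: (n - k)%N => // d ->.
  by rewrite addSn sk ?leq_addl //; exact/esym/g_comp.
move=> sm n mn; rewrite /thread_lim.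
case: pselect => [st|[]]; last by exists m.
case: (cid st) => k /= sk.
rewrite (step k sk (maxn k n)) ?leq_maxl // (step n _ (maxn k n)) ?leq_maxr // => i ni.
exact/sm/(leq_trans mn).
Qed.

Lemma thread_lim_linear a s s' : eventual_thread s -> eventual_thread s' ->
  thread_lim (fun n => a *: s n + s' n) = a *: thread_lim s + thread_lim s'.
Proof.
move=> st st'; have [m'' sm''] := eventual_thread_lin a st st'.
case: st st' => m sm [m' sm'].
pose M := maxn m'' (maxn m m').
rewrite (thread_limE sm'' (n := M)) ?leq_maxl //.
rewrite (thread_limE sm (n := M)); last by rewrite !leq_max leqnn !orbT.
rewrite (thread_limE sm' (n := M)); last by rewrite !leq_max leqnn !orbT.
exact: linearP.
Qed.

Definition branch_term (W : set Br) (p : node_prod) nu : N :=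
  if `[< W nu >] then thread_lim (fun n => p n (res nu n)) else 0.

Definition branch_sum (W : set Br) (p : tree_module) : N :=
  \sum_(nu \in [set: Br]) branch_term W (val p) nu.

(** A branch outside a finite support separates from all the supporting
branches, so the family is eventually 0 along it. *)
Lemma branch_term_supp W l p nu :
  supported l p -> branch_term W p nu != 0 -> nu \in l.
Proof.
move=> lp; apply: contraNT => nul; rewrite /branch_term.
case: ifP => // _.
have [m pm] : exists m, forall n, (m <= n)%N -> p n (res nu n) = 0.
  have : forall l' : seq Br, {subset l' <= l} -> exists m, forall n, (m <= n)%N ->
      forall mu, mu \in l' -> res mu n <> res nu n.
    elim=> [|mu l' IHl] sub; first by exists 0%N.
    have [|m Hm] := IHl; first by move=> x xl; apply: sub; rewrite inE xl orbT.
    have [|m' Hm'] := @res_neq mu nu.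
      by move=> e; move: nul; rewrite -e sub ?mem_head.
    exists (maxn m m') => n; rewrite geq_max => /andP[mn m'n] x; rewrite inE.
    by move=> /orP[/eqP->|xl]; [exact: Hm'|exact: Hm].
  move=> /(_ l (fun=> id))[m Hm]; exists m => n mn.
  by apply/eqP/negPn/negP => /lp[mu mul]; exact: Hm.
rewrite (thread_limE (m := m) _ (n := m)) ?pm ?linear0 // => n mn.
by rewrite !pm ?linear0 // (leq_trans mn).
Qed.

Lemma branch_sumE W l (p : tree_module) : supported l (val p) ->
  branch_sum W p = \sum_(nu <- undup l) branch_term W (val p) nu.
Proof.
move=> lp; rewrite /branch_sum (fsbigE (undup l)) ?undup_uniq //.
  by apply: eq_bigl => nu; rewrite in_setT.
move=> nu _; rewrite mem_undup => nul; apply/eqP; apply: contraNT nul => nz.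
exact: branch_term_supp nz.
Qed.

Lemma branch_sum_linear W : linear (branch_sum W).
Proof.
move=> a p q.
have /treeP[[l _ lp] pt] := valP p; have /treeP[[l' _ lq] qt] := valP q.
have supp_sub (r : node_prod) k k' : {subset k <= k'} -> supported k r -> supported k' r.
  by move=> kk0 kr n t /kr[nu /kk0 nuk e]; exists nu.
have sp : supported (l ++ l') (val p).
  by apply: supp_sub lp => x xl; rewrite mem_cat xl.
have sq : supported (l ++ l') (val q).
  by apply: supp_sub lq => x xl; rewrite mem_cat xl orbT.
have spq : supported (l ++ l') (val (a *: p + q)).
  by rewrite linearP; exact: supported_lin.
rewrite (branch_sumE W sp) (branch_sumE W sq) (branch_sumE W spq).
rewrite scaler_sumr -big_split; apply: eq_bigr => nu _ /=.
rewrite /branch_term; case: ifP => _; last by rewrite scaler0 addr0.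
exact: (thread_lim_linear a (pt nu) (qt nu)).
Qed.

Lemma branch_sum_line W nu s (st : eventual_thread s) :
  branch_sum W (Submod (@line_in_tree setT nu s I st)) =
  if `[< W nu >] then thread_lim s else 0.
Proof.
rewrite (@branch_sumE W [:: nu]); last first.
  move=> n t nz; exists nu; first exact: mem_head.
  by apply: contrapT => ne; move/eqP: nz; apply; apply: line_off => e; exact: ne.
rewrite /= big_seq1 /branch_term; case: ifP => // _; congr thread_lim.
by apply: functional_extensionality_dep => n; rewrite /= line_on.
Qed.

Lemma thread_at_eventual n (x : C n) : eventual_thread (thread_at x).
Proof. by exists n => m; exact: thread_atS. Qed.

Lemma dirac_eventual n (x : C n) : eventual_thread (@dirac S nat C n x).
Proof.
apply: (@eventual_thread0 _ n.+1) => m nm.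
by rewrite /dirac dfwith_out // ltn_eqF.
Qed.

Definition tree_thread nu n (x : C n) : tree_module :=
  Submod (@line_in_tree setT nu _ I (thread_at_eventual x)).

Definition tree_dirac nu n (x : C n) : tree_module :=
  Submod (@line_in_tree setT nu _ I (dirac_eventual x)).

(** A family concentrated at one node is determined by the node, whichever
branch is used to reach it. *)
Lemma tree_dirac_eq nu mu n (x : C n) :
  res nu n = res mu n -> tree_dirac nu x = tree_dirac mu x.
Proof.
move=> e; apply: val_inj; apply: functional_extensionality_dep => i.
apply: funext => t /=; rewrite /line.
have [ei|ne] := eqVneq i n; first by subst i; rewrite e.
by rewrite /dirac dfwith_out 1?eq_sym //; do 2 case: ifP.
Qed.

(** On the thread of x along nu, phi composed with h - h' takes the value g x,
since nu is in W but not in W'.  As h - h' vanishes on families concentrated at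
a node of nu, its values on the threads of x and of f x coincide, and they
assemble to a map on the direct limit. *)
Lemma branch_sum_section (B : lmodType S) (phi : {linear B -> N})
    (W W' : set Br) (h h' : {linear tree_module -> B}) nu :
  branch_sum W =1 phi \o h -> branch_sum W' =1 phi \o h' ->
  W nu -> ~ W' nu ->
  (forall n (x : C n), h (tree_dirac nu x) = h' (tree_dirac nu x)) ->
  exists k : {linear N -> B}, forall y, phi (k y) = y.
Proof.
move=> hW hW' Wnu W'nu hh'.
pose gap n (x : C n) : B := h (tree_thread nu x) - h' (tree_thread nu x).
have gap_lin n : linear (@gap n).
  move=> a x y; rewrite /gap.
  have -> : tree_thread nu (a *: x + y) = a *: tree_thread nu x + tree_thread nu y.
    apply: val_inj; apply: functional_extensionality_dep => i; apply: funext => t.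
    rewrite linearP /=.
    change (line nu (thread_at (a *: x + y)) i t =
      a *: line nu (thread_at x) i t + line nu (thread_at y) i t).
    rewrite /line; case: ifP => _; first exact: thread_at_linear.
    by rewrite scaler0 addr0.
  by rewrite (linearP h) (linearP h') scalerBr opprD addrACA.
have gap_comp n : linear_pack (@gap_lin n.+1) \o f n =1 linear_pack (@gap_lin n).
  move=> x; rewrite /= /linear_pack_fun /gap.
  have -> : tree_thread nu x = tree_dirac nu x + tree_thread nu (f n x).
    apply: val_inj; apply: functional_extensionality_dep => i; apply: funext => t.
    rewrite linearD /=.
    change (line nu (thread_at x) i t =
      line nu (@dirac S nat C n x) i t + line nu (thread_at (f n x)) i t).
    rewrite /line; case: ifP => _; first exact: thread_at_next.
    by rewrite addr0.
  by rewrite (linearD h) (linearD h') hh' opprD addrACA subrr add0r.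
have [k [kE _]] := Ncolim.2 B _ gap_comp; exists k => y.
(* Both phi \o k and the identity are factorizations of g through itself. *)
have [j [_ j_uniq]] := Ncolim.2 N g Ncolim.1.
have := j_uniq (phi \o k : {linear N -> N}); have := j_uniq (idfun : {linear N -> N}).
move=> /(_ (fun n x => erefl)) j1 j2; rewrite [RHS]j1; apply: j2 => n x.
rewrite /= [k _]kE /= /linear_pack_fun /gap linearB.
have -> : phi (h (tree_thread nu x)) = branch_sum W (tree_thread nu x) by rewrite hW.
have -> : phi (h' (tree_thread nu x)) = branch_sum W' (tree_thread nu x) by rewrite hW'.
rewrite !branch_sum_line (asboolT Wnu) (asboolF W'nu) subr0.
rewrite (thread_limE (m := n) _ (n := n)) ?thread_at_id // => i.
exact: thread_atS.
Qed.

End BranchSums.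
End TreeModule.

(** * The tree whose branches are the sets of labelled nodes *)

Section Tree.
Variable H : Type.

Fixpoint tnode n : Type :=
  if n is m.+1 then (tnode m * set (tnode m * H))%type else unit.

Definition tbranch : Type := set {n & tnode n * H}%type.

(** The node of level m+1 on the branch A records which labelled nodes of level
m belong to A. *)
Fixpoint tres (A : tbranch) n : tnode n :=
  match n with
  | 0 => tt
  | m.+1 => (tres A m, [set x | A (existT _ m x)])
  end.

Lemma tres_down A B n : tres A n.+1 = tres B n.+1 -> tres A n = tres B n.
Proof. by case. Qed.

Lemma tres_sep A B : (forall n, tres A n = tres B n) -> A = B.
Proof.
move=> e; apply/seteqP; split=> -[n x] ABx.
  by have [_ /seteqP[/(_ x ABx)]] := e n.+1.
by have [_ /seteqP[_ /(_ x ABx)]] := e n.+1.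
Qed.

End Tree.

(** The Russell set D of the values G A not in A contains G D: otherwise D
itself would witness the membership. *)
Lemma cantor_diagonal (X : Type) (G : set X -> X) :
  exists W W', [/\ G W' = G W, W (G W) & ~ W' (G W)].
Proof.
pose D := [set b | exists2 A, G A = b & ~ A b].
have [A GA nA] : D (G D) by apply: contrapT => nD; apply: (nD); exists D.
by exists D, A; split=> //; exists A.
Qed.

(** * Split surjections and the theorem *)

Section Splitting.
Variables (S : pzRingType) (N B : lmodType S).
Variables (phi : {linear B -> N}) (k : {linear N -> B}).
Hypothesis phik : forall y, phi (k y) = y.

Definition ker_pred : {pred B} := [pred b | phi b == 0].

Fact ker_pred_closed : subsemimod_closed ker_pred.
Proof.
split; first split.
- by rewrite inE linear0.
- by move=> x y; rewrite !inE linearD => /eqP-> /eqP->; rewrite addr0.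
- by move=> a x; rewrite !inE linearZ => /eqP-> /=; rewrite scaler0.
Qed.
HB.instance Definition _ := GRing.isSubmodClosed.Build S B ker_pred ker_pred_closed.

Lemma split_summand : direct_summand N B.
Proof.
exists (submod ker_pred).
have lin : linear (fun x : (N * submod ker_pred)%type => k x.1 + val x.2).
  by move=> a x y; rewrite /= !linearP scalerDr addrACA.
exists (linear_pack lin).
have kerP b : b - k (phi b) \in ker_pred by rewrite inE linearB phik subrr.
exists (fun b => (phi b, Submod (kerP b))) => [[y u]|b].
  have phiu : phi (val u) = 0 by apply/eqP; exact: (valP u).
  have e : phi (k y + val u) = y by rewrite linearD phik phiu addr0.
  rewrite /= /linear_pack_fun /=; congr pair; first exact: e.
  by apply: val_inj; rewrite /= e addrC addKr.
by rewrite /= /linear_pack_fun /= addrC subrK.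
Qed.

End Splitting.

Theorem lemma3p2 (R : pzRingType) (F : rmodType R -> Prop)
    (F_cp : forall C : rmodType R, F C -> countably_presented C)
    (N : rmodType R) (bassN : bass_module F N)
    (N_not_summand :
       ~ exists L : rmodType R, locally_free F L /\ direct_summand N L) :
  ~ exists (L : rmodType R) (f : {linear L -> N}),
      is_precover (locally_free F) f.
Proof.
move=> [B [phi [freeB phi_cover]]].
have [C [f [g [FC Ncolim]]]] := bassN.
pose H : Type := ({n & C n} * B)%type.
have free := tree_locally_free f (@tres_down H) (@tres_sep H) F_cp FC set0.
have lift (W : set (tbranch H)) := phi_cover _
  (linear_pack (branch_sum_linear (@tres_down H) (@tres_sep H) Ncolim W)) free.
have [h hE] := choice lift.
pose dir := tree_dirac f (@tres_down H) (@tres_sep H).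
(* G W is the graph of h W on families concentrated at one node. *)
pose G W : tbranch H := [set x | exists nu n (c : C n),
  x = existT _ n (tres nu n, (existT _ n c, h W (dir nu n c)))].
have [W [W' [GWW' WG W'G]]] := cantor_diagonal G.
apply: N_not_summand; exists B; split=> //.
have agree n (x : C n) : h W (dir (G W) n x) = h W' (dir (G W) n x).
  have : G W (existT _ n (tres (G W) n, (existT _ n x, h W (dir (G W) n x)))).
    by exists (G W), n, x.
  rewrite -{1}GWW' => -[mu [n' [x' e]]].
  have en : n = n' := congr1 (@tag _ _) e; subst n'.
  case: (eq_from_Tagged e) => er ex eh.
  have {}ex : x = x' := eq_from_Tagged ex.
  subst x'.
  by rewrite [LHS]eh; congr (h W' _); apply: tree_dirac_eq.
have [k kE] := branch_sum_section Ncolim (hE W) (hE W') WG W'G agree.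
exact: split_summand kE.
Qed.
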